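(* Let $\mathcal{T}([0,\infty))$ denote the family of all topologically transitive continuous maps $f\colon[0,\infty)\to[0,\infty)$. Then $$\inf\{\operatorname{ent}(f) : f\in\mathcal{T}([0,\infty))\}=\log 3,$$ and there is no map in $\mathcal{T}([0,\infty))$ attaining this bound.
   Context: A continuous map $f\colon X\to X$ of a metric space is (topologically) transitive if for all nonempty open $U,V\subset X$ there is a positive integer $n$ with $f^n(U)\cap V\neq\emptyset$. For a compact set $K\subset X$ with $f(K)\subset K$, $h(f|_K)\in[0,+\infty]$ denotes the usual topological entropy of $f|_K\colon K\to K$ (natural logarithm). The Cánovas–Rodríguez entropy is $\operatorname{ent}(f)=\sup\{h(f|_K) : K\subset X \text{ nonempty, compact, } f(K)\subset K\}$, with the convention $\operatorname{ent}(f)=\infty$ if there is no such $K$. *)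

(* Defs.v *)
From HB Require Import structures.
From mathcomp Require Import all_boot all_order all_algebra finmap.
From mathcomp Require Import all_classical all_reals all_analysis.

Set Implicit Arguments.
Unset Strict Implicit.
Unset Printing Implicit Defensive.

Import Order.TTheory GRing.Theory Num.Theory.
Import numFieldNormedType.Exports.

Local Open Scope classical_set_scope.
Local Open Scope ring_scope.

(* The library makes [set_type A] a pseudometric space (with the subspace
   topology) but not a metric space. *)
Section set_type_metric.
Context {R : realType} {X : metricType R} (A : set X).

Let dist (x y : set_type A) : R := mdist (set_val x) (set_val y).

Let dist_ge0 x y : 0 <= dist x y.
Proof. exact: mdist_ge0. Qed.

Let dist_positivity x y : dist x y = 0 -> x = y.
Proof. by move/mdist_positivity => xy; apply: val_inj; exact: xy. Qed.

Let ballEdist (x : set_type A) d : ball x d = [set y | dist x y < d].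
Proof. by rewrite -initial_ballE ballEmdist. Qed.

HB.instance Definition _ := @PseudoMetric_isMetric.Build R (set_type A)
  dist dist_ge0 dist_positivity ballEdist.

End set_type_metric.

Definition transitive_map (T : topologicalType) (f : T -> T) : Prop :=
  forall U V : set T, open U -> open V -> U !=set0 -> V !=set0 ->
    exists2 n : nat, (0 < n)%N & (iter n f @` U) `&` V !=set0.

Section entropy.
Context {R : realType} {T : metricType R}.
Implicit Types (f : T -> T) (K : set T).

Definition separated_set f (n : nat) (eps : R) (E : set T) : Prop :=
  forall x y, E x -> E y -> x <> y ->
    exists2 k : nat, (k < n)%N & eps < mdist (iter k f x) (iter k f y).

Definition max_separated f K (n : nat) (eps : R) : \bar R :=
  ereal_sup [set (#|` E|%fset%:R)%:E |
    E in [set E : {fset T} | [set` E] `<=` K /\ separated_set f n eps [set` E]]].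

Definition separated_growth f K (eps : R) : \bar R :=
  limn_esup (fun n : nat => ((n%:R^-1)%:E * lne (max_separated f K n eps))%E).

(* Bowen's definition of h(f|_K), meaningful for K nonempty, compact and
   f(K) `<=` K: the iterates of f|_K are then those of f at points of K. The
   growth rate is nonincreasing in eps, so the supremum is the limit as eps
   tends to 0. *)
Definition topological_entropy f K : \bar R :=
  ereal_sup [set separated_growth f K eps | eps in [set eps : R | 0 < eps]].

Definition compact_invariant f : set (set T) :=
  [set K | [/\ K !=set0, compact K & f @` K `<=` K]].

Definition CR_entropy f : \bar R :=
  if `[< compact_invariant f !=set0 >]
  then ereal_sup [set topological_entropy f K | K in compact_invariant f]
  else +oo%E.

End entropy.

Definition transitive_maps (T : topologicalType) : set (T -> T) :=
  [set f | continuous f /\ transitive_map f].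
Arguments transitive_maps T : clear implicits.

(* R^o is R seen as a normed space over itself; the library attaches to it the
   distance `|y - x|. *)
Definition halfline (R : realType) : set R^o := `[0, +oo[.
Arguments halfline R : clear implicits.

(* Main.v *)
(* Lower bound. A transitive [f] leaves no segment [0, r] and no ray [r, +oo[
   invariant, so it has arbitrarily large fixed points, and choosing extremal
   fixed points around extremal jumps yields fixed points [a < b] and
   [a < x < y < b] with [f x > b] and [f y < a]. The three laps of [f] over
   [a, b] form a 3-horseshoe; by transitivity the overflow beyond [b] is
   eventually carried back over [a, b], so that some [f^N] has [3^N + 1]
   separated inverse branches on [a, b], and the entropy is at least
   [ln (3^N + 1) / N > ln 3].

   Upper bound. For [s > 3] the absolute value of an odd zigzag of the line
   with slopes [s] and [-s] is a transitive map of the half-line, whose entropy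
   on a compact set is at most [ln s] because it is [s]-Lipschitz. *)

Require Import Defs.
From mathcomp Require Import all_boot all_order all_algebra finmap.
From mathcomp Require Import all_classical all_reals all_analysis.
From mathcomp Require Import ring lra zify.

Set Implicit Arguments.
Unset Strict Implicit.
Unset Printing Implicit Defensive.

Import Order.TTheory GRing.Theory Num.Theory.
Import numFieldNormedType.Exports.

Local Open Scope classical_set_scope.
Local Open Scope ring_scope.

(** * Growth rates of separated sets *)

Section growth.
Context {R : realType} {T : metricType R}.
Implicit Types (f : T -> T) (K : set T).

(** Every tail of the limsup contains a time [N * l], where the quotient is at least
    [ln (m ^ l) / (N * l) = ln m / N]. *)
Lemma separated_growth_ge f K (eps : R) (N m : nat) :
  (0 < N)%N -> (0 < m)%N ->
  (forall l, exists E : {fset T}, [/\ [set` E] `<=` K,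
     separated_set f (N * l) eps [set` E] & (m ^ l <= #|` E|)%N]) ->
  ((ln m%:R / N%:R)%:E <= separated_growth f K eps)%E.
Proof.
move=> N0 m0 sepE; rewrite /separated_growth /limn_esup limf_esupE.
apply: le_ereal_inf_tmp => _ [V [n0 _ n0V] <-].
set u := fun _ => _.
pose l := n0.+1.
have Nl0 : (0 < N * l)%N by rewrite muln_gt0 N0.
apply: (@le_trans _ _ (u (N * l)%N)); last first.
  apply: ereal_sup_ubound; exists (N * l)%N => //; apply: n0V => /=.
  by rewrite /l; nia.
have [E [EK sE cE]] := sepE l.
rewrite /u.
have ml0 : 0 < (m ^ l)%:R :> R by rewrite ltr0n expn_gt0 m0.
apply: (@le_trans _ _ (((N * l)%N%:R^-1)%:E * lne ((m ^ l)%:R)%:E)%E).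
  rewrite lne_EFin// -EFinM lee_fin natrX lnXn ?ltr0n//.
  rewrite natrM -mulr_natr le_eqVlt; apply/orP; left; apply/eqP.
  by field; rewrite !pnatr_eq0 -!lt0n N0.
rewrite lee_pmul2l// ?lte_fin ?invr_gt0 ?ltr0n//.
have mE : (((m ^ l)%:R)%:E <= max_separated f K (N * l) eps)%E.
  apply: (@le_trans _ _ ((#|` E|%:R)%:E)); first by rewrite lee_fin ler_nat.
  by apply: ereal_sup_ubound; exists E.
have mE0 : (0%:E < max_separated f K (N * l) eps)%E.
  by apply: lt_le_trans mE; rewrite lte_fin.
by rewrite lee_lne// in_itv/= leey andbT ?lee_fin ltW.
Qed.

Lemma separated_growth_le f K (eps C s : R) : 1 <= C -> 0 < s ->
  (forall n (E : {fset T}), [set` E] `<=` K -> separated_set f n eps [set` E] ->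
     #|` E|%:R <= C * s ^+ n) ->
  (separated_growth f K eps <= (ln s)%:E)%E.
Proof.
move=> C1 s0 cE; apply/lee_addgt0Pr => e e0.
rewrite /separated_growth /limn_esup limf_esupE.
(* Beyond [n0] the constant [C] contributes only [ln C / n <= e]. *)
pose n0 := (Num.truncn (ln C / e)).+1.
apply: (@le_trans _ _ (ereal_sup ((fun n : nat =>
   ((n%:R^-1)%:E * lne (max_separated f K n eps))%E) @` [set n | (n0 <= n)%N]))).
  apply: ereal_inf_lbound; exists [set n | (n0 <= n)%N] => //.
  by exists n0.
apply: ge_ereal_sup => _ [n /= n0n <-].
have n_gt0 : (0 < n)%N by apply: leq_trans n0n.
have Cs0 : 0 < C * s ^+ n by rewrite mulr_gt0 ?exprn_gt0// (lt_le_trans ltr01).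
apply: (@le_trans _ _ ((n%:R^-1)%:E * lne (C * s ^+ n)%:E)%E).
  rewrite lee_pmul2l ?lte_fin ?invr_gt0 ?ltr0n//.
  have le1 : (max_separated f K n eps <= (C * s ^+ n)%:E)%E.
    by apply: ge_ereal_sup => _ [E [EK sE] <-]; rewrite lee_fin; exact: cE.
  have le0 : (0%:E <= max_separated f K n eps)%E.
    apply: ereal_sup_ubound; exists fset0; last by rewrite cardfs0.
    by split=> [x|x y]; rewrite /= inE.
  by rewrite lee_lne ?in_itv/= ?leey ?andbT//; exact: le_trans le1.
rewrite lne_EFin// -EFinM -EFinD lee_fin lnM ?posrE ?exprn_gt0//; last first.
  exact: lt_le_trans C1.
rewrite lnXn// mulrDr -[X in _ + _ * X]mulr_natl mulrA mulVf ?mul1r ?pnatr_eq0 -?lt0n//.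
rewrite addrC lerD2l mulrC ler_pdivrMr ?ltr0n// mulrC -ler_pdivrMr//.
apply: (@le_trans _ _ n0%:R); last by rewrite ler_nat.
by apply/ltW; rewrite /n0 truncnS_gt.
Qed.

(** The head of a word is its outermost branch, so [iter N f] deletes the first letter. Points coded
    by two words of length [l] separate in the block of the first differing letter, which gives
    [#|A| ^ l] points separated before time [N * l]. *)
Lemma horseshoe_entropy f K (A : finType) (N : nat) (sg : A -> T -> T)
    (B : set T) (a : T) (eps : R) :
  (0 < N)%N -> (0 < #|A|)%N -> 0 < eps -> B a ->
  (forall i z, B z -> B (sg i z) /\ iter N f (sg i z) = z) ->
  (forall i j z z', i != j -> B z -> B z' -> exists2 k, (k < N)%N &
     eps < mdist (iter k f (sg i z)) (iter k f (sg j z'))) ->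
  (forall w : seq A, K (foldr sg a w)) ->
  ((ln #|A|%:R / N%:R)%:E <= topological_entropy f K)%E.
Proof.
move=> N0 A0 e0 Ba Bsg sgsep Kw.
apply: (@le_trans _ _ (separated_growth f K eps)); last first.
  by apply: ereal_sup_ubound; exists eps.
have Bw w : B (foldr sg a w) by elim: w => //= i w /(Bsg i)[].
have sepw l : forall u v : seq A, size u = l -> size v = l -> u != v ->
  exists2 k, (k < N * l)%N &
    eps < mdist (iter k f (foldr sg a u)) (iter k f (foldr sg a v)).
  elim: l => [|l IH] [|i u] [|j v] //= [su] [sv].
  have [<-|ij] := eqVneq i j.
    rewrite eqseq_cons eqxx/= => uv.
    have [k kl ek] := IH _ _ su sv uv.
    exists (k + N)%N; first by rewrite mulnS addnC ltn_add2l.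
    by rewrite !iterD (Bsg i _ (Bw u)).2 (Bsg i _ (Bw v)).2.
  move=> _; have [k kN ek] := sgsep i j _ _ ij (Bw u) (Bw v).
  by exists k => //; rewrite (leq_trans kN)// mulnS leq_addr.
apply: separated_growth_ge => // l.
pose pt (t : l.-tuple A) := foldr sg a t.
have ptI : injective pt.
  move=> u v uv; apply/val_inj/eqP/negPn/negP => /= nuv.
  have [k _] := sepw l _ _ (size_tuple u) (size_tuple v) nuv.
  by rewrite -/(pt u) -/(pt v) uv mdistxx ltNge ltW.
exists [fset pt t | t in {: l.-tuple A}]%fset; split.
- by move=> x /=  /imfsetP[t _ ->]; exact: Kw.
- move=> x y /= /imfsetP[u _ ->] /imfsetP[v _ ->] uv.
  apply: (sepw l); rewrite ?size_tuple//.
  by apply: contra_not_neq uv => /val_inj ->.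
- by rewrite card_imfset//= -cardE card_tuple.
Qed.

End growth.

(** * Transitive maps have overflowing horseshoes *)

Section real_maps.
Context {R : realType}.
Implicit Types (g h : R -> R).

Lemma continuous_iter (T : topologicalType) (f : T -> T) n :
  continuous f -> continuous (iter n f).
Proof.
move=> cf; elim: n => [|n IH] x /=; first exact: cvg_id.
exact: continuous_comp (IH x) (cf _).
Qed.

Lemma ivt g (u v w : R) : continuous g -> u <= v ->
  g u <= w <= g v \/ g v <= w <= g u -> exists2 c, u <= c <= v & g c = w.
Proof.
move=> cg uv uwv.
have [||c] := @IVT _ g u v w uv; first exact: continuous_subspaceT.
  rewrite ge_min le_max.
  by case: uwv => /andP[-> ->]; rewrite ?orbT.
by rewrite in_itv/=; exists c.
Qed.

Lemma least_point (P : set R) (u v : R) : closed P ->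
  (exists2 t, u <= t <= v & P t) ->
  exists m, [/\ u <= m <= v, P m & forall t, u <= t <= v -> P t -> m <= t].
Proof.
move=> cP [t0 t0uv Pt0].
have cK : compact (P `&` `[u, v]).
  apply: (subclosed_compact _ (@segment_compact R u v)); last exact: subIsetr.
  by apply: closedI => //; exact: itv_closed.
have K0 : P `&` `[u, v] !=set0 by exists t0; split => //=; rewrite in_itv.
have [|m] := @compact_EVT_min R R id _ K0 cK.
  by apply: continuous_subspaceT => t; exact: cvg_id.
rewrite inE /= in_itv/= => -[Pm muv] mmin; exists m; split => // t tuv Pt.
by apply: mmin; rewrite inE; split => //=; rewrite in_itv.
Qed.

Lemma greatest_point (P : set R) (u v : R) : closed P ->
  (exists2 t, u <= t <= v & P t) ->
  exists m, [/\ u <= m <= v, P m & forall t, u <= t <= v -> P t -> t <= m].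
Proof.
move=> cP [t0 t0uv Pt0].
have cK : compact (P `&` `[u, v]).
  apply: (subclosed_compact _ (@segment_compact R u v)); last exact: subIsetr.
  by apply: closedI => //; exact: itv_closed.
have K0 : P `&` `[u, v] !=set0 by exists t0; split => //=; rewrite in_itv.
have [|m] := @compact_EVT_max R R id _ K0 cK.
  by apply: continuous_subspaceT => t; exact: cvg_id.
rewrite inE /= in_itv/= => -[Pm muv] mmin; exists m; split => // t tuv Pt.
by apply: mmin; rewrite inE; split => //=; rewrite in_itv.
Qed.

Lemma closed_fixed g : continuous g -> closed [set t | g t = t].
Proof.
move=> cg.
have -> : [set t | g t = t] = (fun t => g t - t) @^-1` [set 0].
  by apply/seteqP; split => t /= /eqP; [rewrite -subr_eq0|rewrite subr_eq0] => /eqP.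
apply: closed_comp; last exact: closed_eq.
by move=> x _; apply: cvgB; [exact: cg|exact: cvg_id].
Qed.

Lemma closed_ge_fun g (v : R) : continuous g -> closed [set t | v <= g t].
Proof.
move=> cg; apply: (@closed_comp _ _ g [set y | v <= y]); last exact: closed_ge.
by move=> x _; exact: cg.
Qed.

Lemma max_on g (u v : R) : continuous g -> u <= v ->
  exists M, forall t, u <= t <= v -> g t <= M.
Proof.
move=> cg uv; have [|c _ gc] := @EVT_max _ g u v uv.
  exact: continuous_subspaceT.
by exists (g c) => t tuv; apply: gc; rewrite in_itv.
Qed.

Section transitive.
Variable g : R -> R.
Hypothesis cg : continuous g.
Hypothesis tr : forall u v w z, 0 <= u -> u < v -> 0 <= w -> w < z ->
  exists n x, [/\ (0 < n)%N, u < x < v & w < iter n g x < z].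
Hypothesis g_ge0 : forall x, 0 <= g x.

Lemma jump_above r : 0 < r -> exists2 x, 0 <= x <= r & r < g x.
Proof.
move=> r0; apply: contrapT => H.
have gr t : 0 <= t <= r -> 0 <= g t <= r.
  by move=> tr'; rewrite g_ge0/= leNgt; apply/negP => rg; apply: H; exists t.
have [||||n [x [_ xr]]] := @tr 0 r r (r + 1); rewrite ?ltrDl// ?ltW//.
have xr' : 0 <= x <= r by lra.
have : 0 <= iter n g x <= r by elim: n => //= n IH; exact: gr.
lra.
Qed.

Lemma jump_below r : 0 < r -> exists2 y, r <= y & g y < r.
Proof.
move=> r0; apply: contrapT => H.
have gr t : r <= t -> r <= g t.
  by move=> tr'; rewrite leNgt; apply/negP => rg; apply: H; exists t.
have [||||n [x [_ xr]]] := @tr r (r + 1) 0 r; rewrite ?ltrDl// ?ltW//.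
have xr' : r <= x by lra.
have : r <= iter n g x by elim: n => //= n IH; exact: gr.
lra.
Qed.

Lemma fixed_between u v : u <= v ->
  (g u <= u /\ v <= g v) \/ (u <= g u /\ g v <= v) ->
  exists2 p, u <= p <= v & g p = p.
Proof.
move=> uv guv; have ch : continuous (fun t => g t - t).
  by move=> x; apply: cvgB; [exact: cg|exact: cvg_id].
have [|p puv /eqP] := @ivt _ u v 0 ch uv; last first.
  by rewrite subr_eq0 => /eqP; exists p.
by case: guv => -[? ?]; [left|right]; rewrite !(subr_ge0, subr_le0); apply/andP.
Qed.

(** With [r'] bounding [g] on [[0, r]], a point [x] sent above [r' >= x] cannot lie left of [r], and
    it moves up, while [y] moves down; a fixed point lies between them. *)
Lemma fixed_unbounded r : 0 < r -> exists2 p, r <= p & g p = p.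
Proof.
move=> r0; have [y ry gy] := jump_below r0.
have [M gM] := max_on cg (ltW r0).
pose r' := Num.max r M.
have r'0 : 0 < r' by rewrite lt_max r0.
have [x /andP[x0 xr'] gx] := jump_above r'0.
have xgx : x < g x by lra.
move: gx; rewrite gt_max => /andP[_ Mgx].
have rx : r <= x.
  by rewrite leNgt; apply/negP => xr; have := gM x; lra.
have [xy|yx] := leP x y.
  have [|p pp gp] := @fixed_between x y xy; last by exists p => //; lra.
  by right; split; lra.
have [|p pp gp] := @fixed_between y x (ltW yx); last by exists p => //; lra.
by left; split; lra.
Qed.

Lemma overflowing_horseshoe : exists a x y b : R,
  [/\ 0 < a, a < x < y /\ y < b, g a = a /\ g b = b, b < g x & g y < a].
Proof.
(* Since [z0 >= 1], choosing [a] to the right of [z0] will give [0 < a]. *)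
have [z0 z01 gz0] := fixed_unbounded ltr01.
have [M gM] := @max_on g 0 z0 cg ltac:(lra).
(* The level [b0] exceeds all values on [[0, z0]], so the first point [xh] that reaches it lies
   beyond [z0]. *)
pose b0 := Num.max M z0 + 1.
have Mb0 : M < b0 by rewrite /b0 ltr_pwDr// le_max lexx.
have z0b0 : z0 < b0 by rewrite /b0 ltr_pwDr// le_max lexx orbT.
have [x1 x1b0 gx1] := @jump_above b0 ltac:(lra).
have [xh [xhb0 /= gxh xh_min]] : exists m, [/\ 0 <= m <= b0, [set t | b0 <= g t] m
    & forall t, 0 <= t <= b0 -> b0 <= g t -> m <= t].
  apply: least_point; first exact: closed_ge_fun.
  by exists x1 => //=; exact: ltW.
have xhx1 : xh <= x1 by apply: xh_min => //; exact: ltW.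
have z0xh : z0 < xh.
  by rewrite ltNge; apply/negP => ?; have := gM xh; lra.
(* Equality would force [xh = b0 = x1], although [g x1 > b0]. *)
have xh_up : xh < g xh.
  rewrite lt_neqAle; apply/andP; split; last lra.
  apply/eqP => xhE; have x1E : x1 = xh by lra.
  by move: gx1; rewrite x1E; lra.
have [a [axh /= ga a_max]] : exists m, [/\ z0 <= m <= xh, [set t | g t = t] m
    & forall t, z0 <= t <= xh -> g t = t -> t <= m].
  apply: greatest_point; first exact: closed_fixed.
  by exists z0 => //=; lra.
have a_xh : a < xh.
  rewrite lt_neqAle; apply/andP; split; last lra.
  by apply/eqP => axhE; move: ga; rewrite axhE; lra.
(* As [a] is the last fixed point before [xh], the graph stays above the diagonal up to [xh]; hence
   [y], which is sent below [a], lies beyond [xh]. *)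
have a_up t : a < t <= xh -> t < g t.
  move=> tI; rewrite ltNge; apply/negP => gt.
  have [|p pI gp] := @fixed_between t xh ltac:(lra); first by left; split; lra.
  by have := a_max p ltac:(lra) gp; lra.
have [y ay gy] := @jump_below a ltac:(lra).
have xhy : xh < y.
  rewrite ltNge; apply/negP => yxh.
  have [yaE|ya] := eqVneq y a; first by move: gy; rewrite yaE ga ltxx.
  have := a_up y; rewrite lt_neqAle eq_sym ya/= ay/= => /(_ yxh); lra.
have [p0 yp0 gp0] := @fixed_unbounded y ltac:(lra).
have [b [yb /= gb b_min]] : exists m, [/\ y <= m <= p0, [set t | g t = t] m
    & forall t, y <= t <= p0 -> g t = t -> m <= t].
  apply: least_point; first exact: closed_fixed.
  by exists p0 => //=; lra.
have y_b : y < b.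
  rewrite lt_neqAle; apply/andP; split; last lra.
  by apply/eqP => ybE; move: gb; rewrite -ybE; lra.
have b_down t : y <= t < b -> g t < t.
  move=> tI; rewrite ltNge; apply/negP => gt.
  have [|p pI gp] := @fixed_between y t ltac:(lra); first by left; split; lra.
  by have := b_min p ltac:(lra) gp; lra.
have [bb0|b0b] := ltP b b0.
  by exists a, xh, y, b; split => //; lra.
have [x xb gx] := @jump_above b ltac:(lra).
have xhx : xh <= x.
  have [xb0|] := leP x b0; last lra.
  by apply: xh_min; lra.
have xy : x < y.
  rewrite ltNge; apply/negP => yx.
  have [xbE|xb'] := eqVneq x b; first by move: gx; rewrite xbE gb ltxx.
  have := b_down x; rewrite yx/= lt_neqAle xb'/= => /(_ ltac:(lra)); lra.
by exists a, x, y, b; split => //; lra.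
Qed.

Lemma near_lt_dist h (x v : R) : {for x, continuous h} -> v < h x ->
  exists2 d, 0 < d & forall t, `|t - x| < d -> v < h t.
Proof.
move=> ch vh; have /nbhs_ballP[d /= d0 dh] : \forall t \near x, v < h t.
  exact: cvgr_gt ch v vh.
exists d => // t tx.
by apply: dh; rewrite /ball/= distrC.
Qed.

(* Besides the three laps, the overflow [g x > b] yields a fourth inverse
   branch, of a power of [g]: the interval just right of a preimage [x1] of
   the fixed point [b] is eventually mapped across the first lap, away from
   [x1] because [x1] itself sticks to [b]. *)
Lemma horseshoe_branches : exists (a b e : R) (n : nat)
    (I : 'I_3 -> R -> R) (J : R -> R),
  [/\ [/\ 0 < a, a < b, g a = a & 0 < e],
      forall i z, a <= z <= b -> a <= I i z <= b /\ g (I i z) = z,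
      forall z, a <= z <= b -> a <= J z <= b /\ iter n.+1 g (J z) = z,
      forall i j z z', i != j -> a <= z <= b -> a <= z' <= b ->
        e < `|I i z - I j z'|
    & forall i z z', a <= z <= b -> a <= z' <= b -> e < `|J z - I i z'|].
Proof.
have [a [x [y [b [a0 [axy yb] [ga gb] gx gy]]]]] := overflowing_horseshoe.
have [x1 x1I gx1] := @ivt g a x b cg ltac:(lra) ltac:(lra).
have x1x : x1 < x.
  rewrite lt_neqAle; apply/andP; split; last lra.
  by apply/eqP => x1E; move: gx; rewrite -x1E gx1 ltxx.
(* On the margins of width [d] around [x] and [d1] around [y] the map leaves [[a, b]]. Inverse
   branches avoid these margins, and this separates the three laps. *)
have [d d0 dx] := near_lt_dist (@cg x) gx.
have [d1 d10 dy] : exists2 d, 0 < d & forall t, `|t - y| < d -> g t < a.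
  have cgN : {for y, continuous (fun t => - g t)} by apply: cvgN; exact: cg.
  have [|d1 d10 dy] := @near_lt_dist (fun t => - g t) y (- a) cgN; first by rewrite ltrN2.
  by exists d1 => // t /dy; rewrite ltrN2.
(* As [x1] is sent to the fixed point [b] and stays there, while [t0] lands below [a], the [n]-th
   iterate maps [[x1, t0]] across the first lap. *)
have [n [t0 [n0 t0I gt0]]] := @tr x1 x 0 a ltac:(lra) x1x ltac:(lra) a0.
have gnx1 : iter n g x1 = b.
  case: n n0 gt0 => // n _ _; rewrite iterSr gx1.
  by elim: n => //= n ->.
(* The fourth branch has its [n]-th image in [[a, x1]], whereas points near [x1] have theirs beyond
   [x1]; so the branch keeps the distance [d2] from [x1]. *)
have [d2 d20 dx1] : exists2 d, 0 < d & forall t, `|t - x1| < d -> x1 < iter n g t.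
  by apply: near_lt_dist; [exact: continuous_iter|rewrite gnx1; lra].
pose e := Num.min d (Num.min d1 d2) / 2.
have [e0 ed ed1 ed2] : [/\ 0 < e, e < d, e < d1 & e < d2].
  have m0 : 0 < Num.min d (Num.min d1 d2) by rewrite !lt_min d0 d10.
  have : Num.min d (Num.min d1 d2) <= d by rewrite ge_min lexx.
  have : Num.min d (Num.min d1 d2) <= d1 by rewrite !ge_min lexx orbT.
  have : Num.min d (Num.min d1 d2) <= d2 by rewrite !ge_min lexx !orbT.
  clear -m0.
  by rewrite /e; split; lra.
have far (u v w : R) : ~ `|u - v| < w -> u <= v -> u <= v - w.
  by move=> /negP; rewrite -leNgt => uvw uv; move: uvw; rewrite ler0_norm; lra.
have far' (u v w : R) : ~ `|u - v| < w -> v <= u -> v + w <= u.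
  by move=> /negP; rewrite -leNgt => uvw uv; move: uvw; rewrite ger0_norm; lra.
(* Outside [[a, b]] the value 0 is a dummy that makes the branches total functions, as [choice]
   requires. *)
have I0 z : exists t, a <= z <= b -> a <= t <= x1 /\ g t = z.
  have [zI|] := pselect (a <= z <= b); last by exists 0.
  have [t tI gt] := @ivt g a x1 z cg ltac:(lra) ltac:(lra).
  by exists t.
have I1 z : exists t, a <= z <= b -> x + d <= t <= y - d1 /\ g t = z.
  have [zI|] := pselect (a <= z <= b); last by exists 0.
  have [t tI gt] := @ivt g x y z cg ltac:(lra) ltac:(lra).
  exists t => _; split => //; apply/andP; split.
    by apply: far'; [move=> /dx; lra|lra].
  by apply: far; [move=> /dy; lra|lra].
have I2 z : exists t, a <= z <= b -> y + d1 <= t <= b /\ g t = z.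
  have [zI|] := pselect (a <= z <= b); last by exists 0.
  have [t tI gt] := @ivt g y b z cg ltac:(lra) ltac:(lra).
  exists t => _; split => //; apply/andP; split; last lra.
  by apply: far'; [move=> /dy; lra|lra].
have IJ z : exists t, a <= z <= b -> x1 + d2 <= t <= x /\ iter n.+1 g t = z.
  have [zI|] := pselect (a <= z <= b); last by exists 0.
  have [u /(_ zI)[uI gu]] := I0 z.
  have [t tI gt] := @ivt (iter n g) x1 t0 u (continuous_iter cg) ltac:(lra) ltac:(lra).
  exists t => _; split; last by rewrite iterS gt.
  apply/andP; split; last lra.
  by apply: far'; [move=> /dx1; lra|lra].
have [i0 i0P] := choice I0; have [i1 i1P] := choice I1.
have [i2 i2P] := choice I2; have [j jP] := choice IJ.
pose I (i : 'I_3) := match val i with 0%N => i0 | 1%N => i1 | _ => i2 end.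
exists a, b, e, n, I, j; split=> //.
- by split => //; lra.
- case=> -[|[|[|//]]] ? z zI; rewrite /I/=.
  + by have [] := i0P _ zI; split; [lra|].
  + by have [] := i1P _ zI; split; [lra|].
  + by have [] := i2P _ zI; split; [lra|].
- by move=> z zI; have [] := jP _ zI; split; [lra|].
- have sep (u v : R) : u + e < v -> e < `|u - v| /\ e < `|v - u|.
    by move=> uv; rewrite distrC ger0_norm; lra.
  move=> i j' z z' ij zI z'I.
  have [A0 _] := i0P z zI; have [B0 _] := i0P z' z'I.
  have [A1 _] := i1P z zI; have [B1 _] := i1P z' z'I.
  have [A2 _] := i2P z zI; have [B2 _] := i2P z' z'I.
  clear -sep e0 ed ed1 d0 d10 axy yb x1I x1x A0 A1 A2 B0 B1 B2 ij.
  move: i j' ij; case=> -[|[|[|//]]] ? [] [|[|[|//]]] ? //= _; rewrite /I/=;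
    by [apply: (sep _ _ _).1; lra|apply: (sep _ _ _).2; lra].
- move=> i z z' zI z'I; have [A _] := jP z zI.
  have [B0 _] := i0P z' z'I; have [B1 _] := i1P z' z'I; have [B2 _] := i2P z' z'I.
  clear -e0 ed ed1 ed2 d0 d10 d20 axy yb x1I x1x A B0 B1 B2.
  case: i => -[|[|[|//]]] ? /=; rewrite /I/=.
  + by rewrite ger0_norm; lra.
  + by rewrite distrC ger0_norm; lra.
  + by rewrite distrC ger0_norm; lra.
Qed.
End transitive.
End real_maps.

(** * Maps of the half-line *)

Section halfline_maps.
Context {R : realType}.
Local Notation S := (set_type (halfline R)).

Lemma max0_halfline (x : R) : (Num.max x 0 : R^o) \in halfline R.
Proof. by rewrite inE /halfline /= in_itv/= andbT le_max lexx orbT. Qed.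

(** A continuous retraction of the line onto the half-line; truncating at 0 makes it total. *)
Definition to_halfline (x : R) : S := exist _ (Num.max x 0 : R^o) (max0_halfline x).

Definition val_halfline (p : S) : R := set_val p.

Lemma val_halfline_ge0 p : 0 <= val_halfline p.
Proof.
case: p => p pP; rewrite /val_halfline set_valE/=.
by move: pP; rewrite inE /halfline/= in_itv/= andbT.
Qed.

Lemma to_halflineK (x : R) : 0 <= x -> val_halfline (to_halfline x) = x.
Proof. by move=> x0; rewrite /val_halfline set_valE/= max_l. Qed.

Lemma val_halflineK p : to_halfline (val_halfline p) = p.
Proof.
apply/val_inj; have := to_halflineK (val_halfline_ge0 p).
by rewrite /val_halfline set_valE.
Qed.

Lemma continuous_val_halfline : continuous (val_halfline : S -> R).
Proof. exact: initial_continuous. Qed.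

Lemma continuous_to_halfline : continuous (to_halfline : R -> S).
Proof.
apply: (@continuous_comp_initial _ R R^o set_val to_halfline) => x.
by apply: (@continuous_max R R id (cst 0)); [exact: cvg_id|exact: cvg_cst].
Qed.

Lemma mdist_halfline (p q : S) : mdist p q = `|val_halfline p - val_halfline q|.
Proof.
by rewrite distrC.
Qed.

Section dynamics.
Variable f : S -> S.

(** The map [f] read on the whole line, constant on the negative numbers, so that the results on
    real functions apply. *)
Definition real_ext (x : R) : R := val_halfline (f (to_halfline x)).

Lemma iter_real_ext n (p : S) :
  iter n real_ext (val_halfline p) = val_halfline (iter n f p).
Proof. by elim: n => //= n ->; rewrite /real_ext val_halflineK. Qed.

Lemma iter_real_ext_to n (x : R) : 0 <= x ->
  iter n real_ext x = val_halfline (iter n f (to_halfline x)).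
Proof. by move=> x0; rewrite -iter_real_ext to_halflineK. Qed.

Hypothesis cf : continuous f.

Lemma continuous_real_ext : continuous real_ext.
Proof.
move=> x; apply: (@continuous_comp _ _ _ to_halfline (val_halfline \o f)).
  exact: continuous_to_halfline.
by apply: (@continuous_comp _ _ _ f val_halfline);
  [exact: cf|exact: continuous_val_halfline].
Qed.

Lemma real_ext_transitive : transitive_map f ->
  forall u v w z, 0 <= u -> u < v -> 0 <= w -> w < z ->
  exists n x, [/\ (0 < n)%N, u < x < v & w < iter n real_ext x < z].
Proof.
move=> trf u v w z u0 uv w0 wz.
have oI (p q : R) : open (val_halfline @^-1` `]p, q[).
  apply: open_comp; last exact: interval_open.
  by move=> t _; exact: continuous_val_halfline.
have nI (p q : R) : 0 <= p -> p < q -> val_halfline @^-1` `]p, q[ !=set0.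
  move=> p0 pq; exists (to_halfline ((p + q) / 2)).
  by rewrite /= to_halflineK ?in_itv/=; lra.
have [n n0 [_ [[p pI <-] qI]]] := trf _ _ (oI u v) (oI w z) (nI _ _ u0 uv) (nI _ _ w0 wz).
exists n, (val_halfline p); split => //.
by rewrite iter_real_ext; move: qI; rewrite /= in_itv/=.
Qed.

(** The points whose orbits never exceed [M] form a compact invariant set. It contains every coded
    point, because such an orbit returns to [B] every [N] steps until it reaches the fixed point
    [a]. *)
Lemma horseshoe_CR_entropy (A : finType) (N : nat) (sg : A -> S -> S)
    (B : set S) (a : S) (eps M : R) :
  (0 < N)%N -> (0 < #|A|)%N -> 0 < eps -> B a -> f a = a ->
  (forall i z, B z -> B (sg i z) /\ iter N f (sg i z) = z) ->
  (forall i j z z', i != j -> B z -> B z' -> exists2 k, (k < N)%N &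
     eps < mdist (iter k f (sg i z)) (iter k f (sg j z'))) ->
  (forall k z, (k < N)%N -> B z -> val_halfline (iter k f z) <= M) ->
  ((ln #|A|%:R / N%:R)%:E <= CR_entropy f)%E.
Proof.
move=> N0 A0 e0 Ba fa Bsg sgsep BM.
pose K := [set p : S | forall k, val_halfline (iter k f p) <= M].
have Bw w : B (foldr sg a w) by elim: w => //= i w /(Bsg i)[].
have Kw w : K (foldr sg a w).
  elim: w => [k|i w IH k] /=.
    have -> : iter k f a = a by elim: k => //= k ->.
    exact: (BM 0%N).
  have [kN|Nk] := ltnP k N; first by apply: BM => //; exact: (Bsg _ _ _).1.
  by rewrite -(subnK Nk) iterD (Bsg _ _ _).2.
have Kinv : compact_invariant f K.
  split; first by exists a; exact: (Kw [::]).
  - have cI : compact (to_halfline @` `[0, M]).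
      apply: continuous_compact; last exact: segment_compact.
      exact/continuous_subspaceT/continuous_to_halfline.
    apply: (subclosed_compact _ cI); last first.
      move=> p /(_ 0%N) /= pM; exists (val_halfline p); last exact: val_halflineK.
      by rewrite /= in_itv/= val_halfline_ge0.
    have -> : K = \bigcap_k ((fun p => val_halfline (iter k f p)) @^-1` [set x | x <= M]).
      by apply/seteqP; split => [p Kp k _|p Kp k]; [exact: Kp|exact: (Kp k)].
    apply: closed_bigI => k _; apply: closed_comp; last exact: closed_le.
    move=> p _; apply: (@continuous_comp _ _ _ (iter k f) val_halfline).
      exact: continuous_iter.
    exact: continuous_val_halfline.
  - by move=> _ [p Kp <-] k; rewrite -iterSr.
apply: (le_trans (horseshoe_entropy N0 A0 e0 Ba Bsg sgsep Kw)).
rewrite /CR_entropy ifT; last by apply/asboolP; exists K.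
by apply: ereal_sup_ubound; exists K.
Qed.

Lemma CR_entropy_gt_ln3 : transitive_map f -> ((ln 3%:R)%:E < CR_entropy f)%E.
Proof.
move=> trf; set g := real_ext.
have cg : continuous g := continuous_real_ext.
have [a [b [e [n [I [J [[a0 ab ga e0] IP JP IS JS]]]]]]] :=
  horseshoe_branches cg (real_ext_transitive trf) (fun=> val_halfline_ge0 _).
pose I' i (p : S) := to_halfline (I i (val_halfline p)).
pose J' (p : S) := to_halfline (J (val_halfline p)).
pose B := [set p : S | a <= val_halfline p <= b].
have BI i z : B z -> B (I' i z) /\ f (I' i z) = z.
  move=> /(IP i)[II gI]; have I0 : 0 <= I i (val_halfline z) by lra.
  split; first by rewrite /B/= to_halflineK.
  by rewrite -[RHS]val_halflineK -gI /g /real_ext val_halflineK.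
have BJ z : B z -> B (J' z) /\ iter n.+1 f (J' z) = z.
  move=> /JP[II gI]; have I0 : 0 <= J (val_halfline z) by lra.
  split; first by rewrite /B/= to_halflineK.
  by rewrite -[RHS]val_halflineK -gI iter_real_ext_to// val_halflineK.
have BW w z : B z -> B (foldr I' z w) /\ iter (size w) f (foldr I' z w) = z.
  move=> Bz; elim: w => //= i w [Bw fw]; have [BIw fI] := BI i _ Bw.
  by split => //; rewrite -iterS iterSr fI.
have vI i z : B z -> val_halfline (I' i z) = I i (val_halfline z).
  by move=> /(IP i)[II _]; rewrite to_halflineK//; lra.
have vJ z : B z -> val_halfline (J' z) = J (val_halfline z).
  by move=> /JP[II _]; rewrite to_halflineK//; lra.
have sepW u v z z' : size u = size v -> u != v -> B z -> B z' ->
    exists2 k, (k < size u)%N &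
      e < mdist (iter k f (foldr I' z u)) (iter k f (foldr I' z' v)).
  move=> + + Bz Bz'; elim: u v => [|i u IH] [|j v] //= [suv].
  have [Bu _] := BW u _ Bz; have [Bv _] := BW v _ Bz'.
  have [<-|ij _] := eqVneq i j.
    rewrite eqseq_cons eqxx/= => /(IH _ suv)[k ku ek].
    by exists k.+1 => //; rewrite !iterSr (BI _ _ Bu).2 (BI _ _ Bv).2.
  by exists 0%N => //=; rewrite mdist_halfline !vI//; exact: IS.
(* All branches must invert the same iterate: words of [n.+1] laps invert [iter n.+1 f], as [J']
   does. The extra symbol [None] makes the alphabet one larger than [3 ^ n.+1], whence the strict
   inequality. *)
pose sg (o : option (n.+1.-tuple 'I_3)) z :=
  if o is Some w then foldr I' z w else J' z.
have [M gM] : exists M, forall k z, (k < n.+1)%N -> B z -> val_halfline (iter k f z) <= M.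
  suff [M gM] : exists M, forall k t, (k < n.+1)%N -> a <= t <= b -> iter k g t <= M.
    by exists M => k z kn Bz; rewrite -iter_real_ext; exact: gM.
  elim: n.+1 => [|m [M gM]]; first by exists 0.
  have [M' gM'] := max_on (continuous_iter (n := m) cg) (ltW ab).
  exists (Num.max M M') => k t; rewrite ltnS leq_eqVlt => /orP[/eqP ->|km] tI.
    by rewrite le_max gM' ?orbT.
  by rewrite le_max gM.
have cA : #|{: option (n.+1.-tuple 'I_3)}| = (3 ^ n.+1).+1.
  by rewrite card_option card_tuple card_ord.
have a'K : val_halfline (to_halfline a) = a by rewrite to_halflineK// ltW.
apply: (@lt_le_trans _ _ (ln #|{: option (n.+1.-tuple 'I_3)}|%:R / n.+1%:R)%:E).
  rewrite lte_fin ltr_pdivlMr// mulr_natr -lnXn// ltr_ln ?posrE ?exprn_gt0//.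
    by rewrite cA -natrX ltr_nat.
  by rewrite cA.
apply: (@horseshoe_CR_entropy _ n.+1 sg B (to_halfline a) e M) => //.
- by rewrite cA.
- by rewrite /B/= a'K lexx ltW.
- by rewrite -[RHS](val_halflineK) a'K -{2}ga /g /real_ext val_halflineK.
- move=> [w|] z Bz /=; last exact: BJ.
  by have := BW w _ Bz; rewrite size_tuple.
(* A word of length [n.+1] is not empty, so its outermost lap already separates it from [J'] at time
   0. *)
- have JW z z' (w : n.+1.-tuple 'I_3) : B z -> B z' ->
      e < mdist (J' z) (foldr I' z' w).
    move=> Bz Bz'; case/tupleP: w => i w /=; have [Bw _] := BW w _ Bz'.
    by rewrite mdist_halfline vI// vJ//; exact: JS.
  move=> [u|] [v|] z z' uv Bz Bz' //=.
  + have [|//||//|k] := sepW u v z z'; rewrite ?size_tuple//.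
    by exists k.
  + by exists 0%N => //=; rewrite metric_sym; exact: JW.
  + by exists 0%N => //=; exact: JW.
Qed.

End dynamics.

(** * Entropy of Lipschitz maps on bounded sets *)

Lemma compact_halfline_bounded (K : set S) : compact K ->
  exists2 M, 0 < M & forall p, K p -> val_halfline p <= M.
Proof.
move=> cK; have cvK : compact (val_halfline @` K : set R^o).
  apply: continuous_compact cK.
  exact/continuous_subspaceT/continuous_val_halfline.
have [M [_ MK]] := compact_bounded cvK.
have M1 : M < Num.max M 0 + 1 by rewrite ltr_pwDr// le_max lexx.
exists (Num.max M 0 + 1); first by rewrite ltr_wpDl// le_max lexx orbT.
move=> p Kp; have := MK _ M1 (val_halfline p) (imageP _ Kp).
exact: le_trans (ler_norm _).
Qed.

(** Pigeonhole: two points in the same interval [[t * eta, (t + 1) * eta)] would be too close, and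
    [[0, M]] meets at most [M / eta + 1] of these intervals. *)
Lemma card_separated_le (E : {fset S}) (eta M : R) : 0 < eta -> 0 <= M ->
  (forall p, p \in E -> val_halfline p <= M) ->
  (forall p q, p \in E -> q \in E -> p <> q ->
     eta < `|val_halfline p - val_halfline q|) ->
  #|` E|%:R <= M / eta + 1.
Proof.
move=> eta0 M0 EM Esep.
pose m := Num.truncn (M / eta).
pose phi (p : E) : 'I_m.+1 := inord (Num.truncn (val_halfline (val p) / eta)).
have phiI : injective phi.
  move=> p q pq; apply: contrapT => npq.
  have vpq : val p <> val q by move=> /val_inj.
  have := Esep _ _ (valP p) (valP q) vpq.
  have le_m (r : E) : (Num.truncn (val_halfline (val r) / eta) < m.+1)%N.
    by rewrite ltnS; apply: le_truncn; rewrite ler_pM2r ?invr_gt0//; exact: EM (valP r).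
  have tpq : Num.truncn (val_halfline (val p) / eta) =
      Num.truncn (val_halfline (val q) / eta).
    by rewrite -(inordK (le_m p)) -(inordK (le_m q)) -/(phi p) -/(phi q) pq.
  have p0' : 0 <= val_halfline (val p) / eta.
    by rewrite divr_ge0 ?val_halfline_ge0// ltW.
  have q0' : 0 <= val_halfline (val q) / eta.
    by rewrite divr_ge0 ?val_halfline_ge0// ltW.
  have := truncn_itv p0'; rewrite tpq; have := truncn_itv q0'.
  set t := Num.truncn _.
  rewrite !ler_pdivlMr// !ltr_pdivrMr// -natr1 => A1 A2.
  by rewrite ltNge => /negP; apply; rewrite ler_norml; lra.
have := leq_card _ phiI; rewrite card_ord -cardfE -(ler_nat R) => /le_trans; apply.
by rewrite -natr1 lerD2r; rewrite truncn_le ?divr_ge0// ltW.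
Qed.

(** The first [n] iterates expand distances by at most [s ^+ n], so points separated at scale [eps]
    before time [n] are [eps / s ^+ n] apart in some [[0, M]]; their number grows at most like
    [s ^+ n]. *)
Lemma lipschitz_CR_entropy (f : S -> S) (s : R) : 1 <= s ->
  (forall p q, `|val_halfline (f p) - val_halfline (f q)| <=
               s * `|val_halfline p - val_halfline q|) ->
  compact_invariant f !=set0 -> (CR_entropy f <= (ln s)%:E)%E.
Proof.
move=> s1 lipf inv; have s0 : 0 < s by exact: lt_le_trans s1.
rewrite /CR_entropy ifT; last exact/asboolP.
apply: ge_ereal_sup => _ [K [_ cK _] <-].
apply: ge_ereal_sup => _ [eps /= eps0 <-].
have [M M0 KM] := compact_halfline_bounded cK.
have lipn n p q : `|val_halfline (iter n f p) - val_halfline (iter n f q)| <=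
               s ^+ n * `|val_halfline p - val_halfline q|.
  elim: n => [|n IH] /=; first by rewrite mul1r.
  by rewrite exprS -mulrA (le_trans (lipf _ _))// ler_pM2l.
apply: (@separated_growth_le _ _ _ _ _ (M / eps + 1)) => //.
  by rewrite lerDr divr_ge0// ltW.
move=> n E EK sepE; have sn0 : 0 < s ^+ n by rewrite exprn_gt0.
apply: (@le_trans _ _ (M / (eps / s ^+ n) + 1)).
  apply: card_separated_le.
  - by rewrite divr_gt0.
  - exact: ltW.
  - by move=> p pE; apply/KM/EK.
  move=> p q pE qE pq; have [k kn ek] := sepE p q pE qE pq.
  rewrite ltr_pdivrMr// mulrC (lt_le_trans ek)// mdist_halfline.
  by rewrite (le_trans (lipn k p q))// ler_wpM2r// ler_weXn2l// ltnW.
rewrite mulrDl mul1r invf_div mulrA mulrAC lerD2l.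
by rewrite exprn_ege1.
Qed.

End halfline_maps.

(** * Transitive zigzag maps *)

Section zigzag.
Context {R : realType}.
Variable s : R.

(** On [[-1, 1]]: slope [s] through the origin, slope [- s] near both ends, and fixed endpoints, so
    that translates by even integers glue continuously. *)
Definition zigzag_cell (r : R) : R :=
  Num.max (Num.min (s * r) (1 + s - s * r)) (- (1 + s) - s * r).

(* [zigzag] commutes with translation by 2, is odd, and has slopes [s] and
   [-s] alternately; it maps each cell [2k, 2k + 2] to
   [2k - (s - 3) / 2, 2k + 2 + (s - 3) / 2] in three laps. *)
Definition zigzag (x : R) : R :=
  let c := 2 * (Num.floor ((x + 1) / 2))%:~R in c + zigzag_cell (x - c).

Hypothesis s3 : 3 < s.

(** The turning point, where [s * r] and [1 + s - s * r] agree. *)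
Let c : R := (s + 1) / (2 * s).

Let cP : [/\ 3 < s, s * c = (s + 1) / 2, 1 / 2 < c & c < 2 / 3].
Proof.
have hs := s3; have s0 : 0 < s by lra.
split => //; first by rewrite /c; field; rewrite gt_eqF.
  by rewrite /c ltr_pdivlMr; lra.
by rewrite /c ltr_pdivrMr; lra.
Qed.

Let cell_mid r : - c <= r <= c -> zigzag_cell r = s * r.
Proof.
have [? ? ? ?] := cP.
move=> rc; have h1 : s * r <= s * c by rewrite ler_pM2l; lra.
have h2 : s * - c <= s * r by rewrite ler_pM2l; lra.
by rewrite /zigzag_cell min_l ?max_l; lra.
Qed.

Let cell_hi r : c <= r -> zigzag_cell r = 1 + s - s * r.
Proof.
have [? ? ? ?] := cP.
move=> rc; have h1 : s * c <= s * r by rewrite ler_pM2l; lra.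
by rewrite /zigzag_cell min_r ?max_l; lra.
Qed.

Let cell_lo r : r <= - c -> zigzag_cell r = - (1 + s) - s * r.
Proof.
have [? ? ? ?] := cP.
move=> rc; have h1 : s * r <= s * - c by rewrite ler_pM2l; lra.
by rewrite /zigzag_cell max_r// ge_min; apply/orP; left; lra.
Qed.

Let cell_lip r t : `|zigzag_cell r - zigzag_cell t| <= s * `|r - t|.
Proof.
have [? ? ? ?] := cP.
wlog rt : r t / r <= t => [H|].
  by have [/H//|/ltW/H] := leP r t; rewrite distrC (distrC r).
have rt' : s * r <= s * t by rewrite ler_pM2l; lra.
rewrite (@ler0_norm _ (r - t)) ?subr_le0// opprB mulrBr ler_norml /zigzag_cell.
case: (leP (s * r)); case: (leP (s * t)) => ? ?; rewrite /Num.max;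
  case: ifP => ?; case: ifP => ?; lra.
Qed.

Lemma zigzagE (k : int) x : -1 <= x - 2 * k%:~R <= 1 ->
  zigzag x = 2 * k%:~R + zigzag_cell (x - 2 * k%:~R).
Proof.
have [? ? ? ?] := cP.
move=> xk; rewrite /zigzag.
(* At the right end [floor] already selects the next cell; both formulas return the odd number
   [2k + 1]. *)
have [x1|x1] := eqVneq (x - 2 * k%:~R) 1.
  have -> : Num.floor ((x + 1) / 2) = k + 1.
    by apply: floor_def; rewrite !intrD !mulr1z; lra.
  have -> : x - 2 * (k + 1)%:~R = -1 by rewrite intrD mulr1z; lra.
  by rewrite x1 (@cell_hi 1) ?(@cell_lo (-1)) ?intrD ?mulr1z; lra.
have -> // : Num.floor ((x + 1) / 2) = k.
apply: floor_def; rewrite intrD mulr1z.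
have : x - 2 * k%:~R < 1 by rewrite lt_neqAle x1; lra.
lra.
Qed.

Lemma zigzag_up (k : int) x : - c <= x - 2 * k%:~R <= c ->
  zigzag x = 2 * k%:~R + s * (x - 2 * k%:~R).
Proof. by have [? ? ? ?] := cP => xk; rewrite (@zigzagE k) ?cell_mid; lra. Qed.

Lemma zigzag_down (k : int) x : c <= x - 2 * k%:~R <= 2 - c ->
  zigzag x = 2 * k%:~R + 1 - s * (x - 2 * k%:~R - 1).
Proof.
have [? ? ? ?] := cP.
move=> xk; have [x1|x1] := leP (x - 2 * k%:~R) 1.
  by rewrite (@zigzagE k) ?cell_hi; lra.
by rewrite (@zigzagE (k + 1)) ?intrD ?mulr1z ?cell_lo; lra.
Qed.

(** Inside a cell this is [cell_lip]. For different cells, pass through the fixed points [2i + 1]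
    and [2j - 1], the end of the cell of [x] and the start of that of [y]. *)
Lemma zigzag_lip x y : `|zigzag x - zigzag y| <= s * `|x - y|.
Proof.
have [? ? ? ?] := cP.
wlog xy : x y / x <= y => [H|].
  by have [/H//|/ltW/H] := leP x y; rewrite distrC (distrC x).
have cellP (t : R) : -1 <= t - 2 * (Num.floor ((t + 1) / 2))%:~R < 1.
  have := floor_itv ((t + 1) / 2); rewrite intrD mulr1z; lra.
have same (k : int) u v : -1 <= u - 2 * k%:~R <= 1 -> -1 <= v - 2 * k%:~R <= 1 ->
    `|zigzag u - zigzag v| <= s * `|u - v|.
  move=> uk vk; rewrite (zigzagE uk) (zigzagE vk).
  have -> : u - v = (u - 2 * k%:~R) - (v - 2 * k%:~R) by lra.
  by rewrite opprD addrACA subrr add0r; exact: cell_lip.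
have := cellP x; have := cellP y.
set i := Num.floor ((x + 1) / 2); set j := Num.floor ((y + 1) / 2) => yj xi.
have ij : i <= j by apply: le_floor; lra.
have [ijE|ij'] := eqVneq i j; first by move: xi; rewrite ijE => xi; apply: (same j); lra.
have ij1 : i%:~R + 1 <= j%:~R :> R.
  by rewrite -(intrD _ i 1) ler_int; lia.
have fx (k : int) : zigzag (2 * k%:~R + 1) = 2 * k%:~R + 1.
  by rewrite (@zigzag_down k); lra.
have sx := same i x (2 * i%:~R + 1) ltac:(lra) ltac:(lra).
have sy := same j (2 * (j - 1)%:~R + 1) y ltac:(rewrite intrB mulr1z; lra) ltac:(lra).
rewrite !fx intrB mulr1z in sx sy.
rewrite (@ler0_norm _ (x - (_ + 1))) in sx; last lra.
rewrite (@ler0_norm _ (_ + 1 - y)) in sy; last lra.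
rewrite (@ler0_norm _ (x - y)); last lra.
have sij : 2 * j%:~R - 1 - (2 * i%:~R + 1) <= s * (2 * j%:~R - 1 - (2 * i%:~R + 1)).
  by rewrite ler_peMl; lra.
move: sx sy; rewrite !ler_norml; lra.
Qed.

Lemma continuous_zigzag : continuous zigzag.
Proof.
have [? ? ? ?] := cP.
move=> x; apply/cvgrPdist_lt => e e0; near=> y.
apply: (le_lt_trans (zigzag_lip x y)).
rewrite mulrC -ltr_pdivlMr; last lra.
near: y; apply: cvgr_dist_lt; first exact: cvg_id.
by rewrite divr_gt0//; lra.
Unshelve. all: by end_near. Qed.

Lemma zigzagN x : zigzag (- x) = - zigzag x.
Proof.
have [? ? ? ?] := cP.
have := floor_itv ((x + 1) / 2); rewrite intrD mulr1z; set k := Num.floor _ => xk.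
rewrite (@zigzagE (- k) (- x)) ?(@zigzagE k x) ?intrN; [|lra|lra].
have -> : - x - 2 * - k%:~R = - (x - 2 * k%:~R) by lra.
move: (x - 2 * k%:~R) => r.
have [rc|rc] := leP c r; first by rewrite (@cell_hi r) ?(@cell_lo (- r)); lra.
have [rc'|rc'] := leP r (- c); first by rewrite (@cell_lo r) ?(@cell_hi (- r)); lra.
by rewrite (@cell_mid r) ?(@cell_mid (- r)); lra.
Qed.

Lemma iter_zigzagN n x : iter n zigzag (- x) = - iter n zigzag x.
Proof. by elim: n => //= n ->; rewrite zigzagN. Qed.

Lemma zigzag2 (k : int) : zigzag (2 * k%:~R) = 2 * k%:~R.
Proof. by have [? ? ? ?] := cP; rewrite (@zigzag_up k); lra. Qed.

(** * Covering relations for iterates of the zigzag *)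

Definition zigzag_covers n (u v p q : R) :=
  forall w, p <= w <= q -> exists2 x, u <= x <= v & iter n zigzag x = w.

Lemma zigzag_covers_trans n m u v p q p' q' : zigzag_covers n u v p q ->
  zigzag_covers m p q p' q' -> zigzag_covers (m + n) u v p' q'.
Proof.
move=> nc mc w /mc[y /nc[x xI <-] <-]; exists x => //; exact: iterD.
Qed.

Lemma zigzag_covers_sub n u v p q u' v' p' q' : zigzag_covers n u v p q ->
  u' <= u -> v <= v' -> p <= p' -> q' <= q -> zigzag_covers n u' v' p' q'.
Proof.
move=> nc uu vv pp qq w wI; have [|x xI xw] := nc w; first lra.
by exists x => //; lra.
Qed.

Lemma zigzag_coversN n u v p q : zigzag_covers n u v p q ->
  zigzag_covers n (- v) (- u) (- q) (- p).
Proof.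
move=> nc w wI; have [|x xI xw] := nc (- w); first lra.
by exists (- x); rewrite ?iter_zigzagN ?xw; lra.
Qed.

Lemma zigzag_covers1 u v p q : u <= v ->
  zigzag u <= p /\ q <= zigzag v \/ zigzag v <= p /\ q <= zigzag u ->
  zigzag_covers 1 u v p q.
Proof.
move=> uv pq w wI; apply: (@ivt _ zigzag) => //; first exact: continuous_zigzag.
by case: pq => -[? ?]; [left|right]; lra.
Qed.

Let zigzag_top (k : int) : zigzag (2 * k%:~R + c) = 2 * k%:~R + (s + 1) / 2.
Proof.
have [? ? ? ?] := cP; rewrite (@zigzag_up k); last lra.
by rewrite (_ : _ + c - _ = c); lra.
Qed.

Let zigzag_bottom (k : int) : zigzag (2 * k%:~R - c) = 2 * k%:~R - (s + 1) / 2.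
Proof.
have [? ? ? ?] := cP; rewrite (@zigzag_up k); last lra.
by rewrite (_ : _ - c - _ = - c) ?mulrN; lra.
Qed.

(** As [s > 3], the turning values [2k + (s + 1) / 2] and [2k + 2 - (s + 1) / 2] overshoot the cell
    [[2k, 2k + 2]] on both sides. *)
Lemma zigzag_lap_covers (k : int) :
  zigzag_covers 1 (2 * k%:~R - c) (2 * k%:~R + c) (2 * k%:~R) (2 * k%:~R + 2) /\
  zigzag_covers 1 (2 * k%:~R + c) (2 * k%:~R + 2 - c) (2 * k%:~R) (2 * k%:~R + 2).
Proof.
have [? ? ? ?] := cP; have zb := zigzag_bottom (k + 1).
have zt := zigzag_top k; have zb' := zigzag_bottom k.
rewrite intrD mulr1z mulrDr mulr1 in zb.
by split; apply: zigzag_covers1; [lra|left; lra|lra|right; lra].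
Qed.

(** An interval containing no full lap has at most one turning point inside. Its longer piece is at
    least half of it and is stretched by [s > 3], hence the factor [3 / 2]. *)
Lemma zigzag_expand u v : u < v ->
  (exists k : int, zigzag_covers 1 u v (2 * k%:~R) (2 * k%:~R + 2)) \/
  exists p q, zigzag_covers 1 u v p q /\ 3 / 2 * (v - u) <= q - p.
Proof.
have [? ? ? ?] := cP.
(* The shift by [c] makes periods start at a turning point: [2k - c <= u < 2k + 2 - c]. *)
move=> uv; have := floor_itv ((u + c) / 2); rewrite intrD mulr1z.
set k := Num.floor _ => uk.
have su x y : x <= y -> 3 * (y - x) <= s * y - s * x.
  by move=> xy; rewrite -mulrBr ler_wpM2r; lra.
have up x y : u <= x -> y <= v -> (v - u) / 2 <= y - x ->
    - c <= x - 2 * k%:~R -> y - 2 * k%:~R <= c ->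
    exists p q, zigzag_covers 1 u v p q /\ 3 / 2 * (v - u) <= q - p.
  move=> ux yv xyuv xk yk; have xy := su x y ltac:(lra).
  exists (zigzag x), (zigzag y); split.
    apply: (@zigzag_covers_sub _ x y (zigzag x) (zigzag y)) => //.
    by apply: zigzag_covers1; [lra|left].
  by rewrite !(@zigzag_up k); lra.
have down x y : u <= x -> y <= v -> (v - u) / 2 <= y - x ->
    c <= x - 2 * k%:~R -> y - 2 * k%:~R <= 2 - c ->
    exists p q, zigzag_covers 1 u v p q /\ 3 / 2 * (v - u) <= q - p.
  move=> ux yv xyuv xk yk; have xy := su x y ltac:(lra).
  exists (zigzag y), (zigzag x); split.
    apply: (@zigzag_covers_sub _ x y (zigzag y) (zigzag x)) => //.
    by apply: zigzag_covers1; [lra|right].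
  by rewrite !(@zigzag_down k); lra.
have up' x y : u <= x -> y <= v -> (v - u) / 2 <= y - x ->
    2 - c <= x - 2 * k%:~R -> y - 2 * k%:~R <= 2 + c ->
    exists p q, zigzag_covers 1 u v p q /\ 3 / 2 * (v - u) <= q - p.
  move=> ux yv xyuv xk yk; have xy := su x y ltac:(lra).
  exists (zigzag x), (zigzag y); split.
    apply: (@zigzag_covers_sub _ x y (zigzag x) (zigzag y)) => //.
    by apply: zigzag_covers1; [lra|left].
  by rewrite !(@zigzag_up (k + 1)) intrD mulr1z; lra.
have [uc|uc] := leP (2 * k%:~R + c) u.
  have [vc|vc] := leP (2 * k%:~R + 2 + c) v.
    left; exists (k + 1).
    apply: zigzag_covers_sub (zigzag_lap_covers (k + 1)).1 _ _ _ _;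
      rewrite intrD mulr1z; lra.
  right; have [vc'|vc'] := leP v (2 * k%:~R + 2 - c); first by apply: (down u v); lra.
  have [uv2|uv2] := leP ((v - u) / 2) (2 * k%:~R + 2 - c - u).
    by apply: (down u (2 * k%:~R + 2 - c)); lra.
  by apply: (up' (2 * k%:~R + 2 - c) v); lra.
have [vc|vc] := leP (2 * k%:~R + 2 - c) v.
  by left; exists k; apply: zigzag_covers_sub (zigzag_lap_covers k).2 _ _ _ _; lra.
right; have [vc'|vc'] := leP v (2 * k%:~R + c); first by apply: (up u v); lra.
have [uv2|uv2] := leP ((v - u) / 2) (2 * k%:~R + c - u).
  by apply: (up u (2 * k%:~R + c)); lra.
by apply: (down (2 * k%:~R + c) v); lra.
Qed.

Lemma zigzag_reach_cell m u v : u < v -> 4 <= (3 / 2) ^+ m * (v - u) ->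
  exists n (k : int), zigzag_covers n.+1 u v (2 * k%:~R) (2 * k%:~R + 2).
Proof.
have [? ? ? ?] := cP; elim: m u v => [|m IH] u v uv muv.
  (* An interval of length 4 contains the cell [[2k + 2, 2k + 4]], hence its decreasing lap. *)
  have := floor_itv (u / 2); rewrite intrD mulr1z; set k := Num.floor _ => uk.
  exists 0%N, (k + 1); apply: zigzag_covers_sub (zigzag_lap_covers (k + 1)).2 _ _ _ _;
    rewrite intrD mulr1z; lra.
have [[k kc]|[p [q [pqc pq]]]] := zigzag_expand uv; first by exists 0%N, k.
have [||n [k nk]] := IH p q; first lra.
  apply: le_trans muv _; rewrite exprSr -mulrA ler_pM2l ?exprn_gt0//; lra.
by exists n.+1, k; rewrite -(addn1 n.+1); exact: zigzag_covers_trans pqc nk.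
Qed.

Lemma expr_unbounded (q e M : R) : 1 < q -> 0 < e -> exists m, M <= q ^+ m * e.
Proof.
move=> q1 e0; have bern m : 1 + m%:R * (q - 1) <= q ^+ m.
  elim: m => [|m IH]; first by rewrite mul0r addr0.
  rewrite exprS -natr1.
  have : q * (1 + m%:R * (q - 1)) <= q * q ^+ m by rewrite ler_pM2l; lra.
  have : 0 <= m%:R * (q - 1) * (q - 1) by rewrite !mulr_ge0//; lra.
  nra.
exists (Num.truncn (M / e / (q - 1))).+1.
rewrite -ler_pdivrMr//; apply: le_trans (bern _).
have : M / e / (q - 1) <= (Num.truncn (M / e / (q - 1))).+1%:R by exact/ltW/truncnS_gt.
rewrite ler_pdivrMr; lra.
Qed.

(** Even integers are fixed: [2i] stays put, while the excess [eta] beyond [2j] is multiplied by [s]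
    at each step until it passes the turning point [c], whose value exceeds [2j + 2]. *)
Lemma zigzag_covers_overflow m (i j : int) eta : i < j -> 0 < eta ->
  1 <= 3 ^+ m * eta -> exists n,
  zigzag_covers n (2 * i%:~R) (2 * j%:~R + eta) (2 * i%:~R) (2 * j%:~R + 2).
Proof.
have [? ? ? ?] := cP; move=> ij; have ij' : i%:~R < j%:~R :> R by rewrite ltr_int.
have zi := zigzag2 i; have zj := zigzag_top j.
have big e : c <= e ->
    zigzag_covers 1 (2 * i%:~R) (2 * j%:~R + e) (2 * i%:~R) (2 * j%:~R + 2).
  move=> ce; apply: (@zigzag_covers_sub 1 (2 * i%:~R) (2 * j%:~R + c)
    (2 * i%:~R) (2 * j%:~R + 2)); try lra.
  by apply: zigzag_covers1; [lra|left; lra].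
elim: m eta => [|m IH] eta eta0 meta; first by exists 1%N; apply: big; lra.
have [ce|ec] := leP c eta; first by exists 1%N; exact: big.
have se : 3 * eta <= s * eta by rewrite ler_pM2r; lra.
have [||n nc] := IH (s * eta); first lra.
  by apply: le_trans meta _; rewrite exprSr -mulrA ler_pM2l ?exprn_gt0.
exists (n + 1)%N; apply: zigzag_covers_trans nc.
have ze : zigzag (2 * j%:~R + eta) = 2 * j%:~R + s * eta.
  rewrite (@zigzag_up j); last lra.
  by rewrite (_ : _ + eta - _ = eta); lra.
by apply: zigzag_covers1; [lra|left; lra].
Qed.

(** The last peak before [2j] has height [2j + (s - 3) / 2], which supplies the excess that then
    grows. *)
Lemma zigzag_covers_right (i j : int) : i < j -> exists n,
  zigzag_covers n (2 * i%:~R) (2 * j%:~R) (2 * i%:~R) (2 * j%:~R + 2).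
Proof.
have [? ? ? ?] := cP; move=> ij.
have ij' : i%:~R + 1 <= j%:~R :> R by rewrite -(intrD _ i 1) ler_int; lia.
have zi := zigzag2 i; have zj := zigzag_top (j - 1).
have d0 : 0 < (s - 3) / 2 by lra.
have [m hm] := @expr_unbounded 3 ((s - 3) / 2) 1 ltac:(lra) d0.
have [n nc] := zigzag_covers_overflow ij d0 hm.
exists (n + 1)%N; apply: zigzag_covers_trans nc.
rewrite intrB mulr1z in zj.
apply: (@zigzag_covers_sub 1 (2 * i%:~R) (2 * (j%:~R - 1) + c)
  (2 * i%:~R) (2 * j%:~R + (s - 3) / 2)); try lra.
by apply: zigzag_covers1; [lra|left; lra].
Qed.

Lemma zigzag_covers_both (i j : int) : i < j -> exists n,
  zigzag_covers n (2 * i%:~R) (2 * j%:~R) (2 * i%:~R - 2) (2 * j%:~R + 2).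
Proof.
move=> ij; have [n nc] := zigzag_covers_right ij.
(* By oddness, growth to the right of the mirrored interval is growth to the left of
   [[2i, 2j + 2]]. *)
have [|m mc] := @zigzag_covers_right (- (j + 1)) (- i); first lia.
exists (m + n)%N; apply: zigzag_covers_trans nc _.
have := zigzag_coversN mc; rewrite !intrN intrD mulr1z => mc'.
by apply: zigzag_covers_sub mc' _ _ _ _; lra.
Qed.

(** Expansion first covers one cell; the covered interval then gains a cell on each side at every
    round. *)
Lemma zigzag_covers_all (u v w : R) : u < v ->
  exists n x, u <= x <= v /\ iter n.+1 zigzag x = w.
Proof.
move=> uv; have uv' : 0 < v - u by rewrite subr_gt0.
have [m hm] := @expr_unbounded (3 / 2) (v - u) 4 ltac:(lra) uv'.
have [n [k nk]] := zigzag_reach_cell uv hm.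
have grow r : exists n, zigzag_covers n (2 * k%:~R) (2 * k%:~R + 2)
    (2 * k%:~R - 2 * r%:R) (2 * k%:~R + 2 + 2 * r%:R).
  elim: r => [|r [n1 n1c]].
    exists 0%N => y yI; exists y => //; lra.
  have [|n2 n2c] := @zigzag_covers_both (k - r%:Z) (k + 1 + r%:Z); first lia.
  exists (n2 + n1)%N; apply: zigzag_covers_trans n1c _.
  move: n2c; rewrite !intrD !intrN !mulr1z -!pmulrn => n2c.
  by apply: zigzag_covers_sub n2c _ _ _ _; rewrite -?natr1; lra.
pose r := (Num.truncn `|w - 2 * k%:~R|).+1.
have [n' n'c] := grow r.
have wr : `|w - 2 * k%:~R| < r%:R by exact: truncnS_gt.
have [|x xI xw] := zigzag_covers_trans nk n'c (w := w).
  by move: wr; rewrite ltr_norml; lra.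
by exists (n' + n)%N, x; rewrite -addnS.
Qed.

End zigzag.

(** * Folding the zigzag onto the half-line *)

Section zigzag_halfline.
Context {R : realType}.
Local Notation S := (set_type (halfline R)).
Variable s : R.
Hypothesis s3 : 3 < s.

Definition halfline_zigzag (p : S) : S := to_halfline `|zigzag s (val_halfline p)|.

(** Oddness makes the absolute value a semiconjugacy from the zigzag to its folded map. *)
Lemma iter_halfline_zigzag n p :
  val_halfline (iter n halfline_zigzag p) = `|iter n (zigzag s) (val_halfline p)|.
Proof.
elim: n => [|n IH] /=; first by rewrite ger0_norm ?val_halfline_ge0.
rewrite to_halflineK// IH.
have [?|?] := leP 0 (iter n (zigzag s) (val_halfline p)).
  by rewrite (@ger0_norm _ (iter _ _ _)).
by rewrite (@ltr0_norm _ (iter _ _ _))// zigzagN// normrN.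
Qed.

Lemma halfline_zigzag_transitive_maps : transitive_maps S halfline_zigzag.
Proof.
split.
  move=> p; apply: (@continuous_comp _ _ _
    (fun q => `|zigzag s (val_halfline q)|) to_halfline).
    apply: (@continuous_comp _ _ _ (zigzag s \o val_halfline) (fun x : R => `|x|)).
      apply: continuous_comp; first exact: continuous_val_halfline.
      exact: continuous_zigzag.
    exact: norm_continuous.
  exact: continuous_to_halfline.
move=> U V oU _ [p Up] [q Vq].
have /nbhs_ballP[e /= e0 eU] : nbhs (val_halfline p) (to_halfline @^-1` U).
  apply: continuous_to_halfline; rewrite val_halflineK.
  exact: open_nbhs_nbhs.
have p0 := val_halfline_ge0 p.
(* Only the right half of the ball around [p] is used, so that [x] stays nonnegative. *)
have [|n [x [xI xq]]] := @zigzag_covers_all _ s s3 (val_halfline p)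
  (val_halfline p + e / 2) (val_halfline q); first lra.
have x0 : 0 <= x by lra.
exists n.+1 => //; exists q; split => //; exists (to_halfline x).
  by apply: eU; rewrite /ball/= distrC ger0_norm; lra.
rewrite -[RHS]val_halflineK -[LHS]val_halflineK iter_halfline_zigzag.
by rewrite to_halflineK// xq ger0_norm// val_halfline_ge0.
Qed.

Lemma CR_entropy_halfline_zigzag : (CR_entropy halfline_zigzag <= (ln s)%:E)%E.
Proof.
have hs := s3.
apply: lipschitz_CR_entropy; first lra.
  move=> p q; rewrite !to_halflineK//.
  exact: le_trans (ler_dist_dist _ _) (zigzag_lip s3 _ _).
(* The fixed point 0 is a compact invariant set, so the convention giving [+oo] does not apply. *)
exists [set to_halfline 0]; split; first by exists (to_halfline 0).
  exact: compact_set1.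
move=> _ [_ -> <-]; rewrite /= /halfline_zigzag to_halflineK//.
have := zigzag2 s3 0; rewrite mulr0z mulr0 => ->.
by rewrite normr0.
Qed.

End zigzag_halfline.

Theorem theorem15 (R : realType) :
  ereal_inf [set CR_entropy f | f in transitive_maps (set_type (halfline R))]
    = (ln (3%:R : R))%:E
  /\ ~ (exists2 f : set_type (halfline R) -> set_type (halfline R),
          transitive_maps (set_type (halfline R)) f &
          CR_entropy f = (ln (3%:R : R))%:E).
Proof.
split; last first.
  by move=> [f [cf trf] fE]; have := CR_entropy_gt_ln3 cf trf; rewrite fE ltxx.
apply/eqP; rewrite eq_le; apply/andP; split; last first.
  by apply: le_ereal_inf_tmp => _ [f [cf trf] <-]; exact/ltW/CR_entropy_gt_ln3.
(* This slope has [ln s = ln 3 + e]. *)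
apply/lee_addgt0Pr => e e0; pose s : R := 3 * expR e.
have s3 : 3 < s.
  have e1 : 1 < expR e by rewrite expR_gt1.
  by rewrite /s; lra.
apply: (@le_trans _ _ (CR_entropy (halfline_zigzag s))).
  by apply: ereal_inf_lbound; exists (halfline_zigzag s) => //;
    exact: halfline_zigzag_transitive_maps.
apply: le_trans (CR_entropy_halfline_zigzag s3) _.
by rewrite lnM ?posrE ?expR_gt0// expRK EFinD.
Qed.
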